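(* There is a universal constant $a>0$ and, for each $p\in(1,2]$, a constant $c_p>0$ depending only on $p$ such that the following holds. Let $d=1$. For any $\Delta>0$, $L>0$, $p\in(1,2]$, $\sigma\ge0$, $x_1\in\mathbb{R}$, $\gamma>0$, there is $\epsilon_0>0$ (depending on these parameters) such that for every $0<\epsilon\le\sqrt{2\Delta L}$ with $\epsilon\le\epsilon_0$ there exist a differentiable function $f:\mathbb{R}\to\mathbb{R}$ and a stochastic gradient oracle $g$ for $f$ satisfying: (i) $\inf_{x\in\mathbb{R}}f(x)>-\infty$ and $f(x_1)-\inf_{x\in\mathbb{R}}f(x)\le\Delta$; (ii) $|f'(x)-f'(y)|\le L|x-y|$ for all $x,y\in\mathbb{R}$; (iii) $\mathbb{E}_{t-1}[g_t]=f'(x_t)$ and $\mathbb{E}_{t-1}[|g_t-f'(x_t)|^p]\le\sigma^p$ for all $t$, where $g_t$ is the oracle's output at $x_t$; and such that, if AdaGrad with initial point $x_1$, learning rate $\gamma$ and hyperparameter $\lambda=0$ is run on $f$ by interacting with $g$, then every $T\in\mathbb{N}$ with $$\mathbb{E}\left[\frac1T\sum_{t=1}^T|f'(x_t)|\right]\le a\,\epsilon$$ satisfies $$T\ge c_p\left(\frac{\frac{\Delta^2}{\gamma^2}+\gamma^2L^2\ln^2\left(\frac{\gamma L}{\epsilon}\right)}{\epsilon^2}+\frac{\left(\frac{\Delta^2}{\gamma^2}+\gamma^2L^2\ln^2\left(\frac{\gamma L}{\epsilon}\right)\right)\sigma^{\frac{p}{p-1}}}{\epsilon^{\frac{3p-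2}{p-1}}}\right).$$
   Context: One-dimensional AdaGrad with initial point $x_1$, learning rate $\gamma>0$ and hyperparameter $\lambda\ge0$: $v_0=0$ and, for $t=1,2,\dots$, query a stochastic gradient $g_t$ at $x_t$, set $v_t=v_{t-1}+g_t^2$ and $x_{t+1}=x_t-\frac{\gamma}{\lambda+\sqrt{v_t}}g_t$, where the step is read as $0$ when $g_t=0$ (so $0/0=0$ when $\lambda=0$ and $v_t=0$). $\mathcal{F}_t=\sigma(g_1,\dots,g_t)$ ($\mathcal{F}_0$ trivial), $\mathbb{E}_t[\cdot]=\mathbb{E}[\cdot\mid\mathcal{F}_t]$. $\ln^2(\cdot)$ means $(\ln(\cdot))^2$. *)

(* Defs.v *)
From HB Require Import structures.
From mathcomp Require Import all_boot all_order all_algebra finmap.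
From mathcomp Require Import all_classical all_reals all_analysis.
Set Implicit Arguments.
Unset Strict Implicit.
Unset Printing Implicit Defensive.
Import Order.TTheory GRing.Theory Num.Theory.
Import numFieldNormedType.Exports.
Local Open Scope classical_set_scope.
Local Open Scope ring_scope.

Section adagrad.
Context {R : realType}.
Variables (gamma lambda x1 : R).
(* [O t x] is the answer, at time t >= 1, to the query x. *)
Variable O : nat -> R -> R.

(* [adagrad_state n] is the pair (x_{n+1}, v_n).  When g = 0 the step is 0,
   also if lambda + sqrt v' = 0, because [gamma / 0 * 0 = 0]. *)
Fixpoint adagrad_state (n : nat) : R * R :=
  if n is m.+1 then
    let: (x, v) := adagrad_state m in
    let g := O n x in
    let v' := v + g ^+ 2 in
    (x - gamma / (lambda + Num.sqrt v') * g, v')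
  else (x1, 0).

(* Both are meant for t >= 1. *)
Definition adagrad_x (t : nat) : R := (adagrad_state t.-1).1.
Definition adagrad_g (t : nat) : R := O t (adagrad_x t).

End adagrad.

Section probability.
Context {R : realType} {d : measure_display} {Omega : measurableType d}.
Variable P : probability Omega R.

(* xi is a sequence of mutually independent samples of the law mu. *)
Definition iid_samples {d' : measure_display} {Xi : measurableType d'}
    (mu : probability Xi R) (xi : nat -> {RV P >-> Xi}) : Prop :=
  (forall t (B : set Xi), measurable B -> distribution P (xi t) B = mu B) /\
  (forall (J : {fset nat}) (B : nat -> set Xi),
     (forall t, measurable (B t)) ->
     P (\bigcap_(t in [set` J]) (xi t @^-1` B t)) =
     (\prod_(t <- J) P (xi t @^-1` B t))%E).

(* F_t = sigma(g_1, ..., g_t); in particular F_0 = {set0, setT}. *)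
Definition natural_filtration (g : nat -> Omega -> R) (t : nat) :
    set_system Omega :=
  <<s \bigcup_(s in [set s | (1 <= s <= t)%N])
        preimage_set_system [set: Omega] (g s) measurable >>.

(* Y is a version of the conditional expectation E[X | F]. *)
Definition is_cond_expectation (F : set_system Omega) (X Y : Omega -> R) :
    Prop :=
  [/\ P.-integrable [set: Omega] (EFin \o X),
      P.-integrable [set: Omega] (EFin \o Y),
      forall B : set R, measurable B -> F (Y @^-1` B) &
      forall A : set Omega, F A ->
        (\int[P]_(w in A) (Y w)%:E = \int[P]_(w in A) (X w)%:E)%E].

(* E[X | F] <= b almost surely. *)
Definition cond_expectation_le (F : set_system Omega) (X : Omega -> R)
    (b : R) : Prop :=
  exists2 Y : Omega -> R,
    is_cond_expectation F X Y & {ae P, forall w, Y w <= b}.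

End probability.

(* Main.v *)
Require Import Defs.
From HB Require Import structures.
From mathcomp Require Import all_boot all_order all_algebra finmap.
From mathcomp Require Import all_classical all_reals all_analysis.
From mathcomp Require Import measurable_realfun.
From mathcomp Require Import ring lra.
Import Order.TTheory GRing.Theory Num.Theory.
Import numFieldNormedType.Exports.
Local Open Scope classical_set_scope.
Local Open Scope ring_scope.

(** With lambda = 0 AdaGrad is blind to the scale of the gradients: as long as
    all the nonzero answers it receives are equal and negative, its k-th
    effective step is gamma / sqrt k to the right, whatever their size.  The
    points that it visits, here the knots
    x1 + gamma * (1 / sqrt 1 + ... + 1 / sqrt k), are therefore known in
    advance, and a function is free to do what it likes between two of them.

    The function [landscape] has slope -eps at every knot.  Between two knots
    at distance h, its derivative makes a triangular bump, as high as
    L-smoothness allows; the bump raises the function by L h^2 / 4 while the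
    constant slope lowers it by eps h.  Over n gaps the gain is at least
    gamma^2 L ln (n + 1) / 4 and the loss at most 2 eps gamma sqrt n, so that the
    function can stay above its initial value at the knots for N of the order
    of (gamma L ln (gamma L / eps) / eps)^2 gaps ([adagrad_climb],
    [horizon_exists]).  After the last knot the derivative climbs to 0, which
    costs eps^2 / (2 L) <= Delta.  The logarithm tends to infinity when eps
    tends to 0, so for small eps the term Delta^2 / gamma^2 of the bound is
    dominated by the other one, and N is of the order of the noiseless bound.

    The oracle [sparse_oracle] answers Q f' with probability 1 / Q and 0
    otherwise.  A null answer changes neither the iterate nor the accumulated
    squares, and the other answers are all equal to - Q eps: the trajectory is
    the noiseless one, slowed down by a factor Q in the mean
    ([adagrad_sparse_state]).  The bound on the p-th moment of the noise permits
    Q of the order of (sigma / eps)^(p / (p - 1)) ([sparse_oracle_moment],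
    [slowdown_budget]).  Since T / Q nonzero answers are expected during T
    queries, and the slope seen is eps until N of them have come, the expected
    average of |f'| is at least eps (1 - T / (N Q)); if it is at most eps / 2,
    then T >= N Q / 2 ([large_average_slope]).

    What happens up to time n depends on n coin flips only.  Conditional
    expectations are therefore computed by finite sums over the 2^n histories
    ([integral_fresh_sample], [adagrad_cond_expectation]). *)

(** * Piecewise quadratic functions *)

Definition posp {R : realType} (x : R) : R := Num.max x 0.

Definition posp_int {R : realType} (x : R) : R := posp x ^+ 2 / 2.

Lemma posp_pos {R : realType} (x : R) : 0 <= x -> posp x = x.
Proof. exact: max_l. Qed.

Lemma posp_neg {R : realType} (x : R) : x <= 0 -> posp x = 0.
Proof. exact: max_r. Qed.

Lemma pospP {R : realType} (x : R) :
  (0 <= x /\ posp x = x) \/ (x <= 0 /\ posp x = 0).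
Proof.
have [x0|x0] := leP 0 x; first by left; rewrite posp_pos.
by right; rewrite posp_neg ltW.
Qed.

(** Such a bound on the remainder holds uniformly for [posp_int], so that its
    kink at 0 needs no argument of its own. *)
Lemma is_derive_quadratic_remainder {R : realType} (F : R -> R) (x a C : R) :
  (forall h, `|F (x + h) - F x - h * a| <= C * h ^+ 2) -> is_derive x 1 F a.
Proof.
move=> FC.
have Fa : h^-1 *: (F (h *: 1 + x) - F x) @[h --> 0^'] --> a.
  apply/cvgrPdist_le => e e0.
  have C0 : 0 <= C.
    have := FC 1; rewrite expr1n mulr1; exact: le_trans (normr_ge0 _).
  near=> h.
  have h0 : h != 0 by near: h; exact: nbhs_dnbhs_neq.
  rewrite distrC [h *: 1]mulr1 [h + x]addrC.
  have -> : h^-1 *: (F (x + h) - F x) - a = h^-1 * (F (x + h) - F x - h * a).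
    by rewrite /GRing.scale /=; field.
  rewrite normrM normfV ler_pdivrMl ?normr_gt0//.
  apply: (le_trans (FC h)).
  rewrite -real_normK ?num_real// expr2 mulrA mulrC ler_wpM2l//.
  have : `|h| <= e / (C + 1).
    near: h; apply: dnbhs0_le; rewrite divr_gt0//; lra.
  rewrite ler_pdivlMr; last lra.
  move=> hC; apply: (le_trans _ hC); rewrite mulrC ler_wpM2l//; lra.
split; first by apply/cvg_ex; exists a.
by apply: cvg_lim Fa.
Unshelve. all: by end_near.
Qed.

Lemma is_derive_posp_int {R : realType} (x : R) :
  is_derive x 1 posp_int (posp x).
Proof.
apply: (@is_derive_quadratic_remainder _ _ _ _ (1 / 2)) => h.
rewrite /posp_int ler_norml.
case: (pospP x) => -[? ->]; case: (pospP (x + h)) => -[? ->];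
  apply/andP; split; nra.
Qed.

(** The triangle of height w over the interval from l to l + 2 w.  Its three
    kinks, written with [posp], give an explicit antiderivative. *)
Definition hat {R : realType} (l w x : R) : R :=
  posp (x - l) - 2 * posp (x - l - w) + posp (x - l - 2 * w).

Definition hat_int {R : realType} (l w x : R) : R :=
  posp_int (x - l) - 2 * posp_int (x - l - w) + posp_int (x - l - 2 * w).

Definition ramp {R : realType} (l w x : R) : R :=
  posp (x - l) - posp (x - l - w).

Definition ramp_int {R : realType} (l w x : R) : R :=
  posp_int (x - l) - posp_int (x - l - w).

Lemma is_derive_posp_int_shift {R : realType} (c x : R) :
  is_derive x 1 (fun y : R => posp_int (y - c)) (posp (x - c)).
Proof.
have -> : posp (x - c) = posp (x - c) * 1 by rewrite mulr1.
apply: (@is_derive1_comp _ posp_int (fun y : R => y - c)).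
  exact: is_derive_posp_int.
by rewrite -[X in is_derive _ _ _ X]subr0; apply: is_deriveB.
Qed.

Lemma is_derive_hat_int {R : realType} (l w x : R) :
  is_derive x 1 (hat_int l w) (hat l w x).
Proof.
have E k : is_derive x 1 (fun y : R => posp_int (y - l - k)) (posp (x - l - k)).
  under eq_fun do rewrite -addrA -opprD.
  by rewrite -addrA -opprD; exact: is_derive_posp_int_shift.
apply: is_deriveD; apply: is_deriveB.
exact: is_derive_posp_int_shift.
Qed.

Lemma is_derive_ramp_int {R : realType} (l w x : R) :
  is_derive x 1 (ramp_int l w) (ramp l w x).
Proof.
apply: is_deriveB; first exact: is_derive_posp_int_shift.
under eq_fun do rewrite -addrA -opprD.
by rewrite -addrA -opprD; exact: is_derive_posp_int_shift.
Qed.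

Lemma hat_lipschitz {R : realType} (l w x y : R) : 0 <= w ->
  `|hat l w x - hat l w y| <= `|x - y|.
Proof.
move=> w0; wlog xy : x y / x <= y.
  move=> H; have [/H//|/ltW yx] := leP x y.
  by rewrite distrC [leRHS]distrC; exact: H.
rewrite [leRHS]distrC [leRHS]ger0_norm ?subr_ge0// ler_norml /hat.
case: (pospP (x - l)) => -[? ->]; case: (pospP (x - l - w)) => -[? ->];
case: (pospP (x - l - 2 * w)) => -[? ->];
case: (pospP (y - l)) => -[? ->]; case: (pospP (y - l - w)) => -[? ->];
case: (pospP (y - l - 2 * w)) => -[? ->];
apply/andP; split; lra.
Qed.

Lemma hat_left {R : realType} (l w x : R) : 0 <= w -> x <= l -> hat l w x = 0.
Proof. by move=> w0 xl; rewrite /hat !posp_neg; lra. Qed.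

Lemma hat_right {R : realType} (l w x : R) :
  0 <= w -> l + 2 * w <= x -> hat l w x = 0.
Proof. by move=> w0 lx; rewrite /hat !posp_pos; lra. Qed.

Lemma hat_int_ge0 {R : realType} (l w x : R) : 0 <= w -> 0 <= hat_int l w x.
Proof.
move=> w0; rewrite /hat_int /posp_int.
case: (pospP (x - l)) => -[? ->]; case: (pospP (x - l - w)) => -[? ->];
case: (pospP (x - l - 2 * w)) => -[? ->]; nra.
Qed.

Lemma hat_int_left {R : realType} (l w x : R) :
  0 <= w -> x <= l -> hat_int l w x = 0.
Proof. by move=> w0 xl; rewrite /hat_int /posp_int !posp_neg; lra. Qed.

Lemma hat_int_right {R : realType} (l w x : R) :
  0 <= w -> l + 2 * w <= x -> hat_int l w x = w ^+ 2.
Proof. by move=> w0 lx; rewrite /hat_int /posp_int !posp_pos; lra. Qed.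

Lemma ramp_lipschitz {R : realType} (l w x y : R) : 0 <= w ->
  `|ramp l w x - ramp l w y| <= `|x - y|.
Proof.
move=> w0; wlog xy : x y / x <= y.
  move=> H; have [/H//|/ltW yx] := leP x y.
  by rewrite distrC [leRHS]distrC; exact: H.
rewrite [leRHS]distrC [leRHS]ger0_norm ?subr_ge0// ler_norml /ramp.
case: (pospP (x - l)) => -[? ->]; case: (pospP (x - l - w)) => -[? ->];
case: (pospP (y - l)) => -[? ->]; case: (pospP (y - l - w)) => -[? ->];
apply/andP; split; lra.
Qed.

Lemma ramp_left {R : realType} (l w x : R) : 0 <= w -> x <= l -> ramp l w x = 0.
Proof. by move=> w0 xl; rewrite /ramp !posp_neg; lra. Qed.

Lemma ramp_int_left {R : realType} (l w x : R) :
  0 <= w -> x <= l -> ramp_int l w x = 0.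
Proof. by move=> w0 xl; rewrite /ramp_int /posp_int !posp_neg; lra. Qed.

(** Equality holds to the right of l + w; the difference is
    (l + w - x)^2 / 2 on the ramp itself. *)
Lemma ramp_int_ge {R : realType} (l w x : R) : 0 <= w ->
  w * (x - l) - w ^+ 2 / 2 <= ramp_int l w x.
Proof.
move=> w0; rewrite /ramp_int /posp_int.
case: (pospP (x - l)) => -[? ->]; case: (pospP (x - l - w)) => -[? ->]; nra.
Qed.

Lemma ramp_int_ge0 {R : realType} (l w x : R) : 0 <= w -> 0 <= ramp_int l w x.
Proof.
move=> w0; rewrite /ramp_int /posp_int.
case: (pospP (x - l)) => -[? ->]; case: (pospP (x - l - w)) => -[? ->]; nra.
Qed.

(** A segment from x to y that crosses c is cut at c: only u varies on one
    part and only v on the other, so that the two constants do not add up. *)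
Lemma lipschitz_glue {R : realType} (u v : R -> R) (c : R) :
  (forall x y, `|u x - u y| <= `|x - y|) ->
  (forall x y, `|v x - v y| <= `|x - y|) ->
  (forall x, c <= x -> u x = 0) -> (forall x, x <= c -> v x = 0) ->
  forall x y, `|(u x + v x) - (u y + v y)| <= `|x - y|.
Proof.
move=> ulip vlip uc vc x y; wlog xy : x y / x <= y.
  move=> H; have [/H//|/ltW yx] := leP x y.
  by rewrite distrC [leRHS]distrC; exact: H.
have [yc|/ltW cy] := leP y c.
  by rewrite (vc x) ?(vc y) ?addr0//; lra.
have [xc|/ltW cx] := leP x c; last first.
  by rewrite (uc x) ?(uc y) ?add0r//.
rewrite (vc x xc) (uc y cy) addr0 add0r.
have := ulip x c; rewrite (uc c)// subr0 => ux.
have := vlip c y; rewrite (vc c)// sub0r normrN => vy.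
rewrite (le_trans (ler_normB _ _))// (le_trans (lerD ux vy))//.
rewrite !ler0_norm ?subr_le0//; lra.
Qed.

(** * A function that climbs between prescribed points of small slope *)

Section landscape.
Context {R : realType}.
Variables (x1 eps L : R) (h : nat -> R).
Hypotheses (eps0 : 0 <= eps) (L0 : 0 < L) (h0 : forall n, 0 <= h n).

Definition knot (n : nat) : R := x1 + \sum_(j < n) h j.

Lemma knotS n : knot n.+1 = knot n + h n.
Proof. by rewrite /knot big_ord_recr /= addrA. Qed.

Lemma knot_le m n : (m <= n)%N -> knot m <= knot n.
Proof.
elim: n => [|n IH]; first by rewrite leqn0 => /eqP ->.
rewrite leq_eqVlt ltnS => /predU1P[->//|/IH mn].
by rewrite knotS ler_wpDr.
Qed.

Lemma between_knots n x : knot 0 <= x -> x < knot n ->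
  exists2 k, (k < n)%N & knot k <= x < knot k.+1.
Proof.
elim: n => [x0 /lt_geF|n IH x0 xn]; first by rewrite x0.
have [/(IH x0)[k kn xk]|nx] := ltP x (knot n); first by exists k => //; exact: ltnW.
by exists n => //; rewrite nx.
Qed.

(** The bump over each gap of width h j has its foot at both knots and slopes L
    and -L; the final ramp brings the derivative from -eps to 0. *)
Definition landscape (N : nat) (x : R) : R :=
  - eps * (x - x1) +
  L * (\sum_(j < N) hat_int (knot j) (h j / 2) x
       + ramp_int (knot N) (eps / L) x).

Definition landscape' (N : nat) (x : R) : R :=
  - eps + L * (\sum_(j < N) hat (knot j) (h j / 2) x
               + ramp (knot N) (eps / L) x).

Let w0 n : 0 <= h n / 2.
Proof. by rewrite divr_ge0. Qed.

Let e0 : 0 <= eps / L.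
Proof. by rewrite divr_ge0// ltW. Qed.

Let hat_end n : knot n + 2 * (h n / 2) = knot n.+1.
Proof. by rewrite knotS; field. Qed.

Lemma is_derive_landscape (N : nat) (x : R) : is_derive x 1 (landscape N) (landscape' N x).
Proof.
have S : is_derive x 1 (\sum_(j < N) hat_int (knot j) (h j / 2))
    (\sum_(j < N) hat (knot j) (h j / 2) x).
  by apply: is_derive_sum => j; exact: is_derive_hat_int.
have E : landscape N = (- eps) *: (fun y => y - x1) +
   L *: (\sum_(j < N) hat_int (knot j) (h j / 2) + ramp_int (knot N) (eps / L)).
  by apply/funext => y; rewrite /landscape !fctE/= fct_sumE.
rewrite E /landscape'; apply: is_deriveD; last first.
  by apply: is_deriveZ; apply: is_deriveD; exact: is_derive_ramp_int.
rewrite -[X in is_derive _ _ _ X]mulr1; apply: is_deriveZ.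
by rewrite -[X in is_derive _ _ _ X]subr0; apply: is_deriveB.
Qed.

Lemma hats_right N x : knot N <= x ->
  \sum_(j < N) hat (knot j) (h j / 2) x = 0.
Proof.
move=> Nx; apply: big1 => j _; apply: hat_right => //.
by rewrite hat_end (le_trans _ Nx)// knot_le.
Qed.

Lemma hats_lipschitz N x y :
  `|\sum_(j < N) hat (knot j) (h j / 2) x
    - \sum_(j < N) hat (knot j) (h j / 2) y| <= `|x - y|.
Proof.
elim: N x y => [|N IH] x y; first by rewrite !big_ord0 subrr normr0.
rewrite !big_ord_recr/=.
apply: (@lipschitz_glue _ (fun z => \sum_(j < N) hat (knot j) (h j / 2) z)
  (hat (knot N) (h N / 2)) (knot N)) => //.
- by move=> *; exact: hat_lipschitz.
- by move=> z; exact: hats_right.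
- by move=> z; exact: hat_left.
Qed.

Lemma landscape'_lipschitz N x y :
  `|landscape' N x - landscape' N y| <= L * `|x - y|.
Proof.
rewrite /landscape' opprD addrACA subrr add0r -mulrBr normrM (gtr0_norm L0).
rewrite ler_wpM2l ?(ltW L0)//.
apply: (@lipschitz_glue _ (fun z => \sum_(j < N) hat (knot j) (h j / 2) z)
  (ramp (knot N) (eps / L)) (knot N)) => //.
- by move=> *; exact: hats_lipschitz.
- by move=> *; exact: ramp_lipschitz.
- by move=> z; exact: hats_right.
- by move=> z; exact: ramp_left.
Qed.

Lemma landscape'_knot N k : (k < N)%N -> landscape' N (knot k) = - eps.
Proof.
move=> kN; rewrite /landscape' ramp_left ?knot_le ?(ltnW kN)//.
rewrite big1 ?addr0 ?mulr0 ?addr0// => j _.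
have [kj|jk] := leqP k j; first by rewrite hat_left// knot_le.
by rewrite hat_right// hat_end knot_le.
Qed.

Lemma landscape_start N : landscape N x1 = 0.
Proof.
have x1E : x1 = knot 0 by rewrite /knot big_ord0 addr0.
rewrite /landscape subrr mulr0 add0r ramp_int_left//; last by rewrite {1}x1E knot_le.
rewrite big1 ?addr0 ?mulr0// => j _.
by rewrite hat_int_left// {1}x1E knot_le.
Qed.

Lemma hat_ints_ge N n x : (n <= N)%N -> knot n <= x ->
  \sum_(j < n) h j ^+ 2 / 4 <= \sum_(j < N) hat_int (knot j) (h j / 2) x.
Proof.
move=> nN nx.
rewrite (big_ord_widen N (fun j => h j ^+ 2 / 4) nN) big_mkcond/=.
rewrite ler_sum// => j _; case: ifP => jn; last exact: hat_int_ge0.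
rewrite hat_int_right//; first by rewrite exprMn; lra.
by rewrite hat_end (le_trans _ nx)// knot_le.
Qed.

(** The last hypothesis says that the bumps compensate the constant slope up to
    each knot.  Beyond the last knot passed, at most eps h n is lost inside a
    gap, and at most eps^2 / (2 L) on the final ramp. *)
Lemma landscape_ge N B x :
  (forall n, (n < N)%N -> eps * h n <= B) ->
  eps ^+ 2 / (2 * L) <= B ->
  (forall n, (n <= N)%N ->
     eps * \sum_(j < n) h j <= L * \sum_(j < n) h j ^+ 2 / 4) ->
  - B <= landscape N x.
Proof.
move=> hB rB climb; rewrite /landscape.
have ramp0 := ramp_int_ge0 (knot N) _ x e0.
have B0 : 0 <= B by rewrite (le_trans _ rB)// divr_ge0 ?sqr_ge0// mulr_ge0// ltW.
have [xx1|x1x] := ltP x x1.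
  have S0 : 0 <= \sum_(j < N) hat_int (knot j) (h j / 2) x.
    by apply: sumr_ge0 => j _; exact: hat_int_ge0.
  rewrite (le_trans (_ : _ <= 0)) ?oppr_le0// addr_ge0//.
    by rewrite mulNr -mulrN mulr_ge0// oppr_ge0 subr_le0 ltW.
  by rewrite mulr_ge0 ?(ltW L0)// addr_ge0.
have k0 : knot 0 <= x by rewrite /knot big_ord0 addr0.
have [/(between_knots _ _ k0)[n nN /andP[nx xn]]|Nx] := ltP x (knot N).
  have S := hat_ints_ge _ _ _ (ltnW nN) nx.
  have C := climb _ (ltnW nN); have H := hB _ nN.
  move: xn; rewrite knotS {1}/knot => xn.
  have : L * \sum_(j < n) h j ^+ 2 / 4 <=
         L * (\sum_(j < N) hat_int (knot j) (h j / 2) x +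
              ramp_int (knot N) (eps / L) x).
    by rewrite ler_wpM2l ?(ltW L0)//; lra.
  have : eps * (x - x1) <= eps * (\sum_(j < n) h j + h n).
    by rewrite ler_wpM2l//; lra.
  lra.
have S := hat_ints_ge _ _ _ (leqnn N) Nx; have C := climb _ (leqnn N).
have : L * (\sum_(j < N) h j ^+ 2 / 4 +
            (eps / L * (x - knot N) - (eps / L) ^+ 2 / 2)) <=
       L * (\sum_(j < N) hat_int (knot j) (h j / 2) x +
            ramp_int (knot N) (eps / L) x).
  by rewrite ler_wpM2l ?(ltW L0)// lerD// ramp_int_ge.
rewrite mulrDr.
have -> : L * (eps / L * (x - knot N) - (eps / L) ^+ 2 / 2) =
    eps * (x - knot N) - eps ^+ 2 / (2 * L).
  by field; rewrite gt_eqF.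
rewrite /knot; lra.
Qed.

End landscape.

(** * The number of gaps over which AdaGrad's knots allow a climb *)

Lemma ln_le_harmonic {R : realType} (n : nat) :
  ln n.+1%:R <= \sum_(j < n) j.+1%:R^-1 :> R.
Proof.
elim: n => [|n IH]; first by rewrite big_ord0 ln1.
rewrite big_ord_recr/=.
have -> : n.+2%:R = n.+1%:R * (1 + n.+1%:R^-1) :> R.
  by rewrite mulrDr mulr1 mulfV ?pnatr_eq0// -natr1.
have q0 : 0 < 1 + n.+1%:R^-1 :> R by rewrite ltr_wpDr// invr_ge0.
rewrite lnM ?posrE//.
by rewrite lerD// le_ln1Dx// (lt_le_trans (ltrN10 R))// invr_ge0.
Qed.

Lemma sum_inv_sqrt_le {R : realType} (n : nat) :
  \sum_(j < n) (Num.sqrt j.+1%:R)^-1 <= 2 * Num.sqrt n%:R :> R.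
Proof.
elim: n => [|n IH]; first by rewrite big_ord0 mulr_ge0.
rewrite big_ord_recr/=.
set u := Num.sqrt n%:R in IH *; set v := Num.sqrt n.+1%:R.
have v0 : 0 < v by rewrite sqrtr_gt0 ltr0n.
have u0 : 0 <= u by rewrite sqrtr_ge0.
have uv : v ^+ 2 = u ^+ 2 + 1 by rewrite !sqr_sqrtr ?ler0n// natr1.
have : v^-1 <= 2 * (v - u).
  rewrite -[leLHS]mul1r ler_pdivrMr//; nra.
lra.
Qed.

(** The partial sums first increase and then decrease, so that the smallest
    ones are at the two ends. *)
Lemma partial_sums_ge0 {R : realType} (a : nat -> R) (N : nat) :
  (forall m n, (m <= n)%N -> a m <= 0 -> a n <= 0) ->
  0 <= \sum_(j < N) a j ->
  forall n, (n <= N)%N -> 0 <= \sum_(j < n) a j.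
Proof.
move=> sa aN n nN; have [an|an] := leP (a n) 0; last first.
  apply: sumr_ge0 => j _; have [aj|/ltW//] := leP (a j) 0.
  by have := sa j n (ltnW (ltn_ord j)) aj; rewrite leNgt an.
apply: (le_trans aN).
rewrite -!(big_mkord xpredT a) (big_cat_nat _ nN)//=.
rewrite gerDl big_nat_cond sumr_le0// => j /andP[/andP[nj _] _].
exact: sa nj an.
Qed.

(** The gap h is worth L h^2 / 4 - eps h, which is positive when the gap is wide
    and negative when it is narrow.  As the widths decrease, only the total over
    the N gaps matters, and the hypothesis makes it nonnegative. *)
Lemma adagrad_climb {R : realType} (gamma eps L : R) (N : nat) :
  0 < gamma -> 0 < L -> 0 < eps ->
  8 * eps * Num.sqrt N%:R <= gamma * L * ln N.+1%:R ->
  let h j := gamma / Num.sqrt j.+1%:R in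
  forall n, (n <= N)%N ->
    eps * \sum_(j < n) h j <= L * \sum_(j < n) h j ^+ 2 / 4.
Proof.
move=> g0 L0 eps0 epsN h n nN.
have h0 j : 0 < h j by rewrite divr_gt0// sqrtr_gt0.
have E m : L * \sum_(j < m) h j ^+ 2 / 4 - eps * \sum_(j < m) h j =
    \sum_(j < m) (L * (h j ^+ 2 / 4) - eps * h j).
  by rewrite !mulr_sumr -sumrB.
rewrite -subr_ge0 E.
apply: (partial_sums_ge0 (fun j => L * (h j ^+ 2 / 4) - eps * h j) N) nN.
  move=> i j ij; rewrite !subr_le0 !expr2.
  have hji : h j <= h i.
    by rewrite /h ler_pM2l// lef_pV2 ?posrE ?sqrtr_gt0// ler_wsqrtr// ler_nat.
  have := h0 i; have := h0 j; clearbody h => hj hi Hi.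
  have {}Hi : L * h i <= 4 * eps.
    by rewrite -(ler_pM2r hi); nra.
  have {}Hi : L * h j <= 4 * eps by apply: le_trans Hi; rewrite ler_pM2l.
  by move: Hi; rewrite -(ler_pM2r hj); nra.
rewrite -E subr_ge0.
have -> : \sum_(j < N) h j = gamma * \sum_(j < N) (Num.sqrt j.+1%:R)^-1.
  by rewrite mulr_sumr.
have -> : \sum_(j < N) h j ^+ 2 / 4 =
    gamma ^+ 2 / 4 * \sum_(j < N) j.+1%:R^-1.
  rewrite mulr_sumr; apply: eq_bigr => j _.
  by rewrite /h expr_div_n sqr_sqrtr// mulrAC.
have S := sum_inv_sqrt_le N (R := R); have H := ln_le_harmonic N (R := R).
apply: (@le_trans _ _ (eps * (gamma * (2 * Num.sqrt N%:R)))).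
  by rewrite !ler_wpM2l ?(ltW eps0) ?(ltW g0).
apply: (@le_trans _ _ (L * (gamma ^+ 2 / 4 * ln N.+1%:R))); last first.
  by rewrite !ler_wpM2l ?(ltW L0)// mulr_ge0// sqr_ge0.
move: epsN; rewrite -(ler_pM2l g0); nra.
Qed.

(** N is the integer part of (X ln X / 8)^2: the square root of N is at most
    X ln X / 8, while N + 1 >= X.  The largeness of X serves the latter, and
    the loss of at most a factor 2 in the integer part. *)
Lemma horizon_exists {R : realType} (X : R) : 0 < X -> 64 <= ln X ->
  exists N : nat, X ^+ 2 * ln X ^+ 2 / 128 <= N%:R /\
    8 * Num.sqrt N%:R <= X * ln N.+1%:R.
Proof.
move=> X0 lX; have l0 : 0 <= ln X by lra.
have X64 : 64 <= X.
  by rewrite -[X]lnK ?posrE//; have := expR_ge1Dx (ln X); lra.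
pose S := (X * ln X / 8) ^+ 2.
have SE : X ^+ 2 * ln X ^+ 2 / 64 = S by rewrite /S; field.
have S0 : 0 <= S by exact: sqr_ge0.
have XS : 2 * X <= S.
  have : 8 * X <= X * ln X / 8 by nra.
  by rewrite /S; set t := X * ln X / 8 => ?; nra.
exists (Num.trunc S).
have /andP[tS St] := trunc_itv S0.
split.
  have : S < (Num.trunc S)%:R + 1 by rewrite natr1.
  lra.
have sq : Num.sqrt (Num.trunc S)%:R <= X * ln X / 8.
  rewrite -[leRHS]ger0_norm; last by nra.
  by rewrite -sqrtr_sqr ler_wsqrtr.
apply: (@le_trans _ _ (X * ln X)); first by lra.
rewrite ler_pM2l// ler_ln ?posrE//; lra.
Qed.

(** * Integration over finitely many histories of independent flips *)

Definition determined_by {T I S : Type} (K : T -> I) (f : T -> S) : Prop :=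
  forall w w', K w = K w' -> f w = f w'.

Lemma determined_byP {T : pointedType} {I S : Type} (K : T -> I) (f : T -> S) :
  determined_by K f -> exists v : I -> S, forall w, f w = v (K w).
Proof.
move=> Kf; exists (fun i => f (xget point (K @^-1` [set i]))) => w.
apply: Kf; apply/esym.
exact: (@xgetPex _ point (K @^-1` [set K w]) (ex_intro _ w erefl)).
Qed.

Section finite_valued.
Context {R : realType} {d : measure_display} {T : measurableType d}.
Variables (P : probability T R) (I : finType) (K : T -> I).
Hypothesis mK : forall i, measurable (K @^-1` [set i]).

Let simple_sum (v : I -> R) w :
  (v (K w))%:E = (\sum_i (v i)%:E * (\1_(K @^-1` [set i]) w)%:E)%E.
Proof.
rewrite (bigD1 (K w))//= indicE mem_set// mule1 big1 ?adde0// => i iK.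
rewrite indicE memNset ?mule0//= => /esym Ki.
by move: iK; rewrite Ki eqxx.
Qed.

Lemma integrable_finite (v : I -> R) :
  P.-integrable [set: T] (fun w => (v (K w))%:E).
Proof.
under eq_fun do rewrite simple_sum.
apply: integrable_sum => // i _; apply: integrableZl => //.
exact: integrable_indic.
Qed.

Lemma integral_finite (v : I -> R) :
  (\int[P]_w (v (K w))%:E)%E =
  (\sum_i v i * fine (P (K @^-1` [set i])))%:E.
Proof.
under eq_integral do rewrite simple_sum.
rewrite integral_sum//; last first.
  by move=> i; apply: integrableZl => //; exact: integrable_indic.
rewrite -sumEFin; apply: eq_bigr => i _.
rewrite integralZl//; last exact: integrable_indic.
by rewrite integral_indic// setIT EFinM fineK// fin_num_measure.
Qed.

End finite_valued.

Section history.
Context {R : realType} {d : measure_display} {Omega : measurableType d}.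
Variables (P : probability Omega R) (q : R) (xi : nat -> {RV P >-> bool}).
Hypothesis q01 : 0 <= q <= 1.
Hypothesis xi_iid : iid_samples (bernoulli_prob q) xi.

Definition history (n : nat) (w : Omega) : {ffun 'I_n -> bool} :=
  [ffun i : 'I_n => xi i.+1 w].

Lemma historyP n w w' :
  history n w = history n w' <->
  forall s, (0 < s <= n)%N -> xi s w = xi s w'.
Proof.
split => [/ffunP E [//|s] /= sn|E].
  by have := E (Ordinal sn); rewrite !ffunE.
by apply/ffunP => i; rewrite !ffunE E/=.
Qed.

Lemma history_le m n w w' : (m <= n)%N ->
  history n w = history n w' -> history m w = history m w'.
Proof.
move=> mn /historyP ww'; apply/historyP => s /andP[s0 sm].
by apply: ww'; rewrite s0 (leq_trans sm).
Qed.

Let mxi s (B : set bool) : measurable (xi s @^-1` B).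
Proof. by rewrite -[X in measurable X]setTI; exact: measurable_funP. Qed.

Let bernoulli_fiber s b :
  P (xi s @^-1` [set b]) = (if b then q else 1 - q)%:E.
Proof.
have [D _] := xi_iid.
have := D s [set b] I; rewrite /distribution /pushforward/= => ->.
rewrite bernoulli_probE// !diracE; case: b.
  by rewrite mem_set// memNset//= mule1 mule0 adde0.
by rewrite memNset// mem_set//= mule1 mule0 add0e.
Qed.

(* [h] is extended by [false] outside of the times 1, ..., n. *)
Let history_bigcap n (h : {ffun 'I_n -> bool}) :
  history n @^-1` [set h] =
  \bigcap_(t in [set` [fset t in iota 1 n]%fset])
    xi t @^-1` [set if insub t.-1 is Some i then h i else false].
Proof.
apply/seteqP; split => [w /= <- [|t]/=|w H].
- by rewrite inE mem_iota.
- by rewrite inE mem_iota add1n ltnS /= => tn; rewrite insubT ffunE.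
apply/ffunP => i; rewrite ffunE.
have := H i.+1; rewrite /= valK; apply.
by rewrite inE mem_iota /= add1n ltnS.
Qed.

(** Independence, applied to the times 1, ..., n + 1. *)
Lemma history_step n h b :
  P (history n @^-1` [set h] `&` xi n.+1 @^-1` [set b]) =
  (P (history n @^-1` [set h]) * (if b then q else 1 - q)%:E)%E.
Proof.
have [_ ind] := xi_iid.
set J := [fset t in iota 1 n]%fset.
pose B t : set bool :=
  if t == n.+1 then [set b]
  else [set if insub t.-1 is Some i then h i else false].
have nJ : n.+1 \notin J.
  by rewrite inE mem_iota add1n ltnn andbF.
have JB t : t \in J -> xi t @^-1` B t =
    xi t @^-1` [set if insub t.-1 is Some i then h i else false].
  by move=> tJ; rewrite /B; case: eqP => // tn; rewrite -tn tJ in nJ.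
have hB : history n @^-1` [set h] = \bigcap_(t in [set` J]) xi t @^-1` B t.
  by rewrite history_bigcap; apply: eq_bigcapr => t /= /JB.
have hbB : history n @^-1` [set h] `&` xi n.+1 @^-1` [set b] =
    \bigcap_(t in [set` (n.+1 |` J)%fset]) xi t @^-1` B t.
  rewrite hB set_fsetU bigcap_setU setIC; congr (_ `&` _).
  by rewrite set_fset1 bigcap_set1 /B eqxx.
rewrite hbB hB !ind// big_fsetU1//= {1}/B eqxx bernoulli_fiber.
by rewrite muleC.
Qed.

Lemma measurable_history n i : measurable (history n @^-1` [set i]).
Proof.
by rewrite history_bigcap; apply: fin_bigcap_measurable.
Qed.

Lemma measurable_history_step n i :
  measurable ((fun w => (history n w, xi n.+1 w)) @^-1` [set i]).
Proof.
have -> : (fun w => (history n w, xi n.+1 w)) @^-1` [set i] =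
    history n @^-1` [set i.1] `&` xi n.+1 @^-1` [set i.2].
  by case: i => h b; apply/seteqP; split => w /= [-> ->].
by apply: measurableI => //; exact: measurable_history.
Qed.

(** On each of the finitely many histories, [A] is everything or nothing and [u]
    is a constant function of the next flip, which does not depend on the
    history; so the flip can be averaged out inside the integral. *)
Lemma integral_fresh_sample n (A : set Omega) (u : Omega -> bool -> R) :
  determined_by (history n) A ->
  (forall b, determined_by (history n) (u^~ b)) ->
  (\int[P]_(w in A) (u w (xi n.+1 w))%:E =
   \int[P]_(w in A) (q * u w true + (1 - q) * u w false)%:E)%E.
Proof.
move=> /determined_byP[a aE] uh.
have [/(_ true)/determined_byP[ut utE] /(_ false)/determined_byP[uf ufE]] :=
  (uh, uh).
rewrite integral_mkcond [RHS]integral_mkcond.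
pose v (i : {ffun 'I_n -> bool} * bool) : R :=
  if `[< a i.1 >] then (if i.2 then ut i.1 else uf i.1) else 0.
pose m (h : {ffun 'I_n -> bool}) : R := q * v (h, true) + (1 - q) * v (h, false).
transitivity (\int[P]_w (v (history n w, xi n.+1 w))%:E)%E.
  apply: eq_integral => w _; rewrite /patch /v/=.
  have -> : (w \in A) = `[< a (history n w) >] by rewrite -aE.
  by case: asboolP => // _; case: (xi n.+1 w); rewrite ?utE ?ufE.
rewrite (integral_finite P _ _ (measurable_history_step n)).
transitivity (\int[P]_w (m (history n w))%:E)%E; last first.
  apply: eq_integral => w _; rewrite /patch /m /v/=.
  have -> : (w \in A) = `[< a (history n w) >] by rewrite -aE.
  by case: asboolP => // _; rewrite ?mulr0 ?addr0 ?utE ?ufE.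
rewrite (integral_finite P _ _ (measurable_history n)); congr (_%:E).
pose F h b := v (h, b) *
  fine (P ((fun w => (history n w, xi n.+1 w)) @^-1` [set (h, b)])).
transitivity (\sum_i F i.1 i.2); first by apply: eq_bigr => -[].
rewrite -(pair_bigA _ F)/=; apply: eq_bigr => h _; rewrite big_bool /m /F.
have E b : fine (P ((fun w => (history n w, xi n.+1 w)) @^-1` [set (h, b)])) =
    fine (P (history n @^-1` [set h])) * (if b then q else 1 - q).
  have -> : (fun w => (history n w, xi n.+1 w)) @^-1` [set (h, b)] =
      history n @^-1` [set h] `&` xi n.+1 @^-1` [set b].
    by apply/seteqP; split => w /= [-> ->].
  by rewrite history_step fineM ?fin_num_measure//; exact: measurable_history.
by rewrite !E/=; clearbody v; ring.
Qed.

End history.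

(** * AdaGrad as an adapted process *)

Section process.
Context {R : realType} {d : measure_display} {Omega : measurableType d}.
Variables (gamma lambda x1 : R).
Hypothesis lambda0 : 0 <= lambda.

Lemma adagrad_state_eq (O O' : nat -> R -> R) n :
  (forall s, (0 < s <= n)%N -> O s =1 O' s) ->
  adagrad_state gamma lambda x1 O n = adagrad_state gamma lambda x1 O' n.
Proof.
elim: n => [//|n IH] OO' /=; rewrite IH; last first.
  by move=> s /andP[s0 sn]; apply: OO'; rewrite s0 ltnW.
by case: (adagrad_state _ _ _ _ n) => x v; rewrite OO' ?leqnn.
Qed.

Lemma adagrad_stateS (O : nat -> R -> R) n :
  let x := adagrad_x gamma lambda x1 O in
  let v n := (adagrad_state gamma lambda x1 O n).2 in
  let g := adagrad_g gamma lambda x1 O in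
  v n.+1 = v n + g n.+1 ^+ 2 /\
  x n.+2 = x n.+1 - gamma / (lambda + Num.sqrt (v n.+1)) * g n.+1.
Proof.
rewrite /adagrad_g /adagrad_x /=.
by case: (adagrad_state gamma lambda x1 O n) => x v.
Qed.

Lemma adagrad_v_ge0 (O : nat -> R -> R) n :
  0 <= (adagrad_state gamma lambda x1 O n).2.
Proof.
elim: n => [//|n IH]; have [-> _] := adagrad_stateS O n.
by rewrite addr_ge0// sqr_ge0.
Qed.

(** The sets determined by [K] form a sigma-algebra. *)
Lemma natural_filtration_determined {I : Type} (K : Omega -> I)
    (g : nat -> Omega -> R) n A :
  (forall s, (0 < s <= n)%N -> determined_by K (g s)) ->
  natural_filtration g n A -> determined_by K A.
Proof.
move=> Kg; move: A; apply: smallest_sub.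
  split => [|A KA|F KF] w w' ww'.
  - by [].
  - by apply/propext; rewrite /setD /mkset (KA _ _ ww').
  - apply/propext; split => -[i _ Fi]; exists i => //; move: Fi.
      by rewrite (KF i _ _ ww').
    by rewrite -(KF i _ _ ww').
move=> A [s /= sn [B mB <-]] w w' ww'.
by apply/propext; rewrite /setI /mkset /= (Kg s sn _ _ ww').
Qed.

(** The recursion for the iterate and the accumulated squares uses only the
    gradients observed so far, through measurable operations. *)
Lemma adagrad_x_measurable (O : Omega -> nat -> R -> R) n (B : set R) :
  let x t w := adagrad_x gamma lambda x1 (O w) t in
  let g t w := adagrad_g gamma lambda x1 (O w) t in
  measurable B -> natural_filtration g n (x n.+1 @^-1` B).
Proof.
move=> x g mB.
pose G := \bigcup_(s in [set s | (1 <= s <= n)%N])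
            preimage_set_system [set: Omega] (g s) measurable.
pose T : measurableType _ := g_sigma_algebraType G.
have mg s : (0 < s <= n)%N -> measurable_fun [set: T] (g s : T -> R).
  by move=> sn _ C mC; apply: sub_gen_smallest; exists s => //; exists C.
pose v m w := (adagrad_state gamma lambda x1 (O w) m).2.
have [mx _] : measurable_fun [set: T] (x n.+1 : T -> R) /\
              measurable_fun [set: T] (v n : T -> R).
  have := leqnn n; elim: {-2}n => [_|m IH mn].
    by split; exact: measurable_cst.
  have [mx mv] := IH (ltnW mn); have {}mg := mg m.+1 mn.
  have mv' : measurable_fun [set: T] (v m.+1 : T -> R).
    have -> : v m.+1 = (fun w => v m w + g m.+1 w ^+ 2).
      by apply/funext => w; exact: (adagrad_stateS (O w) m).1.
    by apply: measurable_funD => //; exact: measurable_funX.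
  split => //.
  (* the inverse and the square root are written as real powers, which are
     measurable on the whole line *)
  have -> : x m.+2 = (fun w => x m.+1 w -
      gamma * ((lambda + v m.+1 w `^ 2^-1) `^ (-1)) * g m.+1 w).
    apply/funext => w; rewrite powR12_sqrt; last exact: adagrad_v_ge0.
    rewrite powR_inv1; first exact: (adagrad_stateS (O w) m).2.
    by rewrite addr_ge0// sqrtr_ge0.
  apply: measurable_funB => //; apply: measurable_funM => //.
  apply: measurable_funM; first exact: measurable_cst.
  apply: (measurableT_comp (measurable_powR (-1))).
  apply: measurable_funD; first exact: measurable_cst.
  exact: (measurableT_comp (measurable_powR 2^-1)).
by have := mx measurableT B mB; rewrite setTI.
Qed.

End process.

(** * The sparse oracle *)

(** Where the slope exceeds eps the answer is exact, so that the moment bound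
    holds at every point and not only along the trajectory. *)
Definition sparse_oracle {R : realType} (slope : R -> R) (eps Q y : R)
    (b : bool) : R :=
  if `|slope y| <= eps then (if b then Q * slope y else 0) else slope y.

Section sparse_oracle.
Context {R : realType}.
Variables (slope : R -> R) (eps Q : R).
Hypothesis Q1 : 1 <= Q.

Lemma measurable_sparse_oracle : measurable_fun [set: R] slope ->
  measurable_fun [set: R * bool]
    (fun z => sparse_oracle slope eps Q z.1 z.2).
Proof.
move=> mslope.
have m b : measurable_fun [set: R] (fun y => sparse_oracle slope eps Q y b).
  have mle : measurable_fun [set: R] (fun y => `|slope y| <= eps).
    apply: measurable_fun_ler; last exact: measurable_cst.
    exact: measurableT_comp.
  apply: measurable_fun_if => //; last exact: measurable_funTS.
  case: b; last exact: measurable_cst.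
  by apply: measurable_funTS; apply: measurable_funM => //; exact: measurable_cst.
rewrite (_ : (fun z => _) = (fun z : R * bool =>
  if z.2 then sparse_oracle slope eps Q z.1 true
         else sparse_oracle slope eps Q z.1 false)).
  exact: (measurable_fun_if_pair (m true) (m false)).
by apply/funext => -[y []].
Qed.

Let Q0 : 0 < Q. Proof. exact: lt_le_trans Q1. Qed.

Lemma sparse_oracle_mean y :
  Q^-1 * sparse_oracle slope eps Q y true +
  (1 - Q^-1) * sparse_oracle slope eps Q y false = slope y.
Proof.
rewrite /sparse_oracle; case: ifP => _; last by ring.
by field; rewrite gt_eqF.
Qed.

(** The noise is at most Q eps with probability 1 / Q and at most eps otherwise,
    so that its moment is at most eps^p (Q^(p - 1) + 1).  There is no noise at
    all when Q = 1, hence the condition in the last hypothesis. *)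
Lemma sparse_oracle_moment p sigma y : 1 < p -> 0 <= sigma ->
  (1 < Q -> 2 * (eps `^ p * Q `^ (p - 1)) <= sigma `^ p) ->
  Q^-1 * `|sparse_oracle slope eps Q y true - slope y| `^ p +
  (1 - Q^-1) * `|sparse_oracle slope eps Q y false - slope y| `^ p
    <= sigma `^ p.
Proof.
move=> p1 sigma0 budget; have p0 : p != 0 by rewrite gt_eqF//; lra.
rewrite /sparse_oracle; case: ifP => [small|_]; last first.
  by rewrite subrr normr0 powR0// !mulr0 addr0 powR_ge0.
rewrite sub0r normrN.
have -> : Q * slope y - slope y = (Q - 1) * slope y by ring.
have [Q1'|Q1'] := eqVneq Q 1.
  by rewrite Q1' invr1 !subrr mul0r normr0 powR0// mulr0 mul0r addr0 powR_ge0.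
have {}Q1' : 1 < Q by rewrite lt_neqAle eq_sym Q1'.
apply: le_trans (budget Q1').
have sp : `|slope y| `^ p <= eps `^ p.
  apply: ge0_ler_powR => //; rewrite ?nnegrE//; first by lra.
  exact: le_trans small.
have QQ : Q * Q `^ (p - 1) = Q `^ p by apply: mulr_powRB1; lra.
have Qp1 : 1 <= Q `^ (p - 1).
  by rewrite -[leLHS](powRr0 Q) ler_powR//; lra.
have Qp : (Q - 1) `^ p <= Q `^ p.
  by apply: ge0_ler_powR => //; rewrite ?nnegrE; lra.
rewrite normrM powRM// ger0_norm; last by lra.
have s0 : 0 <= `|slope y| `^ p by exact: powR_ge0.
have e0 : 0 <= eps `^ p by exact: powR_ge0.
have a : Q^-1 * ((Q - 1) `^ p * `|slope y| `^ p) <= eps `^ p * Q `^ (p - 1).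
  rewrite ler_pdivrMl// mulrCA QQ mulrC.
  by apply: ler_pM => //; exact: powR_ge0.
have b : (1 - Q^-1) * `|slope y| `^ p <= eps `^ p * Q `^ (p - 1).
  rewrite mulrC; apply: ler_pM => //.
    by rewrite subr_ge0 invf_le1.
  apply: le_trans Qp1; rewrite gerBl invr_ge0; exact: ltW.
lra.
Qed.

End sparse_oracle.

Section trajectory.
Context {R : realType}.
Variables (gamma x1 eps Q : R) (slope : R -> R) (N : nat).
Hypotheses (eps0 : 0 < eps) (Q0 : 0 < Q).
Let y := knot x1 (fun j => gamma / Num.sqrt j.+1%:R).
Hypothesis slope_knot : forall k, (k < N)%N -> slope (y k) = - eps.

(** The m-th nonzero answer - Q eps makes the square root of the accumulated
    squares equal to sqrt m * (Q eps), so that the step is gamma / sqrt m. *)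
Lemma adagrad_sparse_state (b : nat -> bool) n :
  let m := (\sum_(1 <= s < n.+1) b s)%N in
  (m < N)%N ->
  adagrad_state gamma 0 x1 (fun s z => sparse_oracle slope eps Q z (b s)) n =
  (y m, m%:R * (Q * eps) ^+ 2).
Proof.
elim: n => [|n IH]/=.
  by rewrite big_geq//= mul0r /y /knot big_ord0 addr0.
rewrite big_nat_recr//=.
set m := (\sum_(1 <= s < n.+1) b s)%N in IH *.
have Qe : 0 < Q * eps by rewrite mulr_gt0.
case bn: (b n.+1) => /= mN; last first.
  rewrite addn0 in mN *; rewrite IH// /sparse_oracle slope_knot// normrN gtr0_norm//.
  by rewrite lexx mulr0 subr0 expr0n/= addr0.
rewrite addn1 in mN *; have {}IH := IH (ltnW mN); rewrite IH.
rewrite /sparse_oracle slope_knot ?(ltnW mN)// normrN gtr0_norm// lexx.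
have -> : m%:R * (Q * eps) ^+ 2 + (Q * - eps) ^+ 2 =
    m.+1%:R * (Q * eps) ^+ 2 by rewrite -natr1; ring.
congr (_, _); rewrite add0r sqrtrM// sqrtr_sqr (gtr0_norm Qe) /y knotS.
congr (_ + _); field.
by rewrite !gt_eqF// sqrtr_gt0.
Qed.

(** With m nonzero answers before time t, the slope at time t is at least
    eps (1 - m / N): it equals eps if m < N, and the bound is nonpositive
    otherwise.  This linear minorant makes the expectation a matter of the mean
    number of nonzero answers. *)
Lemma adagrad_sparse_slope (b : nat -> bool) T : (0 < N)%N -> (0 < T)%N ->
  eps - eps / N%:R * \sum_(1 <= s < T.+1) (b s)%:R <=
  T%:R^-1 * \sum_(1 <= t < T.+1)
    `|slope (adagrad_x gamma 0 x1
        (fun s z => sparse_oracle slope eps Q z (b s)) t)|.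
Proof.
move=> N0 T0; rewrite ler_pdivlMl ?ltr0n//.
set lhs := (X in _ * X <= _).
have -> : T%:R * lhs = \sum_(1 <= t < T.+1) lhs.
  by rewrite big_const_nat subSS subn0 iter_addr_0 mulr_natl.
rewrite big_nat_cond [leRHS]big_nat_cond.
apply: ler_sum => -[|t]; rewrite andbT//= ltnS => tT.
rewrite /adagrad_x /=; have := adagrad_sparse_state b t; cbv zeta.
set m := (\sum_(1 <= s < t.+1) b s)%N => state.
have mS : m%:R <= \sum_(1 <= s < T.+1) (b s)%:R :> R.
  rewrite -natr_sum ler_nat (@big_cat_nat _ _ _ t.+1 1 T.+1)//=.
    exact: leq_addr.
  exact: leq_trans tT _.
have eN : 0 < eps / N%:R by rewrite divr_gt0// ltr0n.
have [mN|Nm] := ltnP m N.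
  rewrite state//= slope_knot// normrN gtr0_norm// gerBl.
  by rewrite mulr_ge0 ?(ltW eN)// sumr_ge0.
apply: le_trans (normr_ge0 _); rewrite subr_le0.
rewrite -{1}(divfK (_ : N%:R != 0) eps) ?pnatr_eq0 -?lt0n//.
by rewrite ler_pM2l// (le_trans _ mS)// ler_nat.
Qed.

End trajectory.

(** * Conditional expectations along the trajectory *)

Section fresh_samples.
Context {R : realType} {d : measure_display} {Omega : measurableType d}.
Variables (P : probability Omega R) (q : R) (xi : nat -> {RV P >-> bool}).
Hypothesis q01 : 0 <= q <= 1.
Hypothesis xi_iid : iid_samples (bernoulli_prob q) xi.
Variables (gamma lambda x1 : R) (G : R -> bool -> R).
Hypothesis lambda0 : 0 <= lambda.

Let x (t : nat) (w : Omega) : R :=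
  adagrad_x gamma lambda x1 (fun s y => G y (xi s w)) t.
Let g (t : nat) (w : Omega) : R :=
  adagrad_g gamma lambda x1 (fun s y => G y (xi s w)) t.

Lemma adagrad_x_determined n : determined_by (history P xi n) (x n.+1).
Proof.
move=> w w' /historyP ww'; rewrite /x /adagrad_x/=.
rewrite (@adagrad_state_eq _ _ _ _ _ (fun s y => G y (xi s w')))//.
by move=> s sn z; rewrite ww'.
Qed.

Lemma adagrad_g_determined n s : (0 < s <= n)%N ->
  determined_by (history P xi n) (g s).
Proof.
case: s => // s sn w w' ww'; rewrite /g /adagrad_g -!/(x _ _).
rewrite (adagrad_x_determined s w w' (history_le P xi s n w w' (ltnW sn) ww')).
by move: ww' => /historyP ->.
Qed.

Lemma integrable_determined n (f : Omega -> R) :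
  determined_by (history P xi n) f -> P.-integrable [set: Omega] (EFin \o f).
Proof.
move=> /determined_byP[v fv]; have -> : f = v \o history P xi n.
  exact/funext.
exact: (integrable_finite P _ _ (measurable_history P xi n)).
Qed.

(** The iterate is known at time n and the next flip is fresh.  The case u = G
    gives the conditional mean of the next gradient; a power of its deviation
    gives the conditional moment of the noise. *)
Lemma adagrad_cond_expectation n (u : R -> bool -> R) :
  (forall b, measurable_fun [set: R] (u^~ b)) ->
  is_cond_expectation P (natural_filtration g n)
    (fun w => u (x n.+1 w) (xi n.+1 w))
    (fun w => q * u (x n.+1 w) true + (1 - q) * u (x n.+1 w) false).
Proof.
move=> mu_b; have xdet := adagrad_x_determined n; split.
- apply: (integrable_determined n.+1) => w w' ww'.
  rewrite (xdet _ _ (history_le P xi _ _ w w' (leqnSn n) ww')).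
  by move: ww' => /historyP ->//; rewrite leqnn.
- by apply: (integrable_determined n) => w w' ww'; rewrite (xdet _ _ ww').
- move=> B mB.
  pose m z := q * u z true + (1 - q) * u z false.
  have mm : measurable_fun [set: R] m.
    apply: measurable_funD; apply: measurable_funM => //; exact: measurable_cst.
  have := adagrad_x_measurable gamma lambda x1 lambda0
    (fun w s z => G z (xi s w)) n (m @^-1` B); apply.
  by rewrite -[X in measurable X]setTI; exact: mm.
- move=> A FA; symmetry.
  apply: (integral_fresh_sample P q xi q01 xi_iid n A (fun w => u (x n.+1 w))).
    apply: natural_filtration_determined FA => s sn.
    exact: adagrad_g_determined.
  by move=> b w w' ww'; rewrite (xdet _ _ ww').
Qed.

Lemma expected_sample s :
  (0 < s)%N -> (\int[P]_w ((xi s w : nat)%:R)%:E = q%:E :> \bar R)%E.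
Proof.
case: s => // s _.
rewrite (integral_fresh_sample P q xi q01 xi_iid s setT (fun _ b => b%:R))//.
under eq_integral do rewrite mulr1 mulr0 addr0.
by rewrite integral_cst// [X in (_ * X)%E]probability_setT mule1.
Qed.

Lemma expected_sample_sum (a b : R) T :
  (\int[P]_w (a - b * \sum_(1 <= s < T.+1) (xi s w : nat)%:R)%:E =
   (a - b * (T%:R * q))%:E)%E.
Proof.
have xiint s : P.-integrable [set: Omega] (fun w => ((xi s.+1 w : nat)%:R)%:E).
  apply: (integrable_determined s.+1 (fun w => (xi s.+1 w : nat)%:R)).
  by move=> w w' /historyP ->//; rewrite leqnn.
pose S w := (\sum_(s < T) ((xi s.+1 w : nat)%:R)%:E : \bar R)%E.
have SE w : (a - b * \sum_(1 <= s < T.+1) (xi s w : nat)%:R)%:E =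
    (a%:E + (- b)%:E * S w)%E.
  by rewrite big_add1/= big_mkord -mulNr EFinD EFinM -sumEFin.
under eq_integral do rewrite SE.
have Sint : P.-integrable [set: Omega] S by exact: integrable_sum.
have aint : P.-integrable [set: Omega] (cst a%:E).
  exact: finite_measure_integrable_cst.
rewrite integralD//; last exact: integrableZl.
rewrite integralZl// integral_cst// [X in (_ * X + _)%E]probability_setT mule1.
have -> : (\int[P]_w S w = (T%:R * q)%:E)%E.
  rewrite integral_sum// (eq_bigr (fun=> q%:E)); last first.
    by move=> s _; exact: expected_sample.
  by rewrite sumEFin sumr_const card_ord mulr_natl.
by rewrite -EFinM -EFinD mulNr.
Qed.

End fresh_samples.

(** * Rates *)

Lemma measurable_lipschitz {R : realType} (L : R) (u : R -> R) : 0 < L ->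
  (forall x y, `|u x - u y| <= L * `|x - y|) -> measurable_fun [set: R] u.
Proof.
move=> L0 uL; apply: continuous_measurable_fun => x.
apply/cvgrPdist_le => e e0; near=> y; apply: le_trans (uL x y) _.
rewrite mulrC -ler_pdivlMr//; near: y.
by apply: cvgr_dist_le; [exact: cvg_id|rewrite divr_gt0].
Unshelve. all: by end_near.
Qed.

Definition noise_ratio {R : realType} (p sigma eps : R) : R :=
  (sigma / eps) `^ (p / (p - 1)).

(** The largest Q with 2 eps^p Q^(p - 1) <= sigma^p, or 1 if that is smaller. *)
Definition slowdown {R : realType} (p sigma eps : R) : R :=
  Num.max 1 (noise_ratio p sigma eps / 2 `^ (p - 1)^-1).

Section rates.
Context {R : realType}.
Variables (p sigma eps : R).
Hypotheses (p1 : 1 < p) (sigma0 : 0 <= sigma) (eps0 : 0 < eps).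

Lemma slowdown_ge1 : 1 <= slowdown p sigma eps.
Proof. by rewrite /slowdown le_max lexx. Qed.

Lemma slowdown_budget : 1 < slowdown p sigma eps ->
  2 * (eps `^ p * slowdown p sigma eps `^ (p - 1)) <= sigma `^ p.
Proof.
rewrite /slowdown lt_max ltxx /= => Q1; rewrite max_r; last exact: ltW.
have pn : p - 1 != 0 by rewrite gt_eqF// subr_gt0.
set b := 2 `^ (p - 1)^-1.
have nE : noise_ratio p sigma eps `^ (p - 1) = (sigma / eps) `^ p.
  by rewrite -powRrM divfK.
have bE : (b^-1) `^ (p - 1) = 2^-1.
  have b2 : b `^ (p - 1) = 2 by rewrite -powRrM mulVf// powRr1.
  by rewrite -powR_inv1 ?powR_ge0// powRAC b2 powR_inv1.
have sE : eps `^ p * (sigma / eps) `^ p = sigma `^ p.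
  by rewrite -powRM ?divr_ge0 ?(ltW eps0)// mulrC divfK// gt_eqF.
rewrite powRM ?powR_ge0 ?invr_ge0 ?powR_ge0// nE bE (mulrA (eps `^ p)) sE.
by rewrite mulrC divfK.
Qed.

Lemma noise_ratio_le :
  1 + noise_ratio p sigma eps <= (1 + 2 `^ (p - 1)^-1) * slowdown p sigma eps.
Proof.
set b := 2 `^ (p - 1)^-1; have b0 : 0 < b by exact: powR_gt0.
rewrite mulrDl mul1r lerD ?slowdown_ge1//.
by rewrite -ler_pdivrMl// mulrC /slowdown le_max lexx orbT.
Qed.

Lemma noisy_rateE (K : R) :
  K / eps ^+ 2 +
    K * sigma `^ (p / (p - 1)) / eps `^ ((3 * p - 2) / (p - 1)) =
  K / eps ^+ 2 * (1 + noise_ratio p sigma eps).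
Proof.
have pn : p - 1 != 0 by rewrite gt_eqF// subr_gt0.
have e0 : 0 <= eps by exact: ltW.
have eE : eps `^ ((3 * p - 2) / (p - 1)) = eps ^+ 2 * eps `^ (p / (p - 1)).
  have -> : (3 * p - 2) / (p - 1) = 2%:R + p / (p - 1) by field.
  by rewrite powRD ?powR_mulrn// (gt_eqF eps0) implybT.
have nE : noise_ratio p sigma eps = sigma `^ (p / (p - 1)) / eps `^ (p / (p - 1)).
  rewrite /noise_ratio powRM ?invr_ge0//; congr (_ * _).
  by rewrite -powR_inv1// powRAC powR_inv1// powR_ge0.
rewrite eE nE; field.
by rewrite !gt_eqF//; exact: powR_gt0.
Qed.

End rates.

(** Taking expectations in [adagrad_sparse_slope], where T / Q nonzero answers
    are expected, gives eps (1 - T / (N Q)) <= eps / 2. *)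
Lemma large_average_slope {R : realType} {d : measure_display}
    {Omega : measurableType d} (P : probability Omega R)
    (xi : nat -> {RV P >-> bool}) (gamma x1 eps Q : R) (slope : R -> R)
    (N T : nat) :
  0 < eps -> 1 <= Q -> (0 < N)%N -> (0 < T)%N ->
  (forall k, (k < N)%N ->
     slope (knot x1 (fun j => gamma / Num.sqrt j.+1%:R) k) = - eps) ->
  iid_samples (bernoulli_prob Q^-1) xi ->
  ('E_P[fun w => (T%:R^-1 * \sum_(1 <= t < T.+1) `|slope (adagrad_x gamma 0 x1
       (fun s y => sparse_oracle slope eps Q y (xi s w)) t)|)%R]
     <= (2^-1 * eps)%:E)%E ->
  N%:R * Q <= 2 * T%:R.
Proof.
move=> eps0 Q1 N0 T0 slope_knot xi_iid avg.
have Q0 : 0 < Q by exact: lt_le_trans Q1.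
have q01 : 0 <= Q^-1 <= 1 by rewrite invr_ge0 (ltW Q0) invf_le1.
have xdet t := adagrad_x_determined P xi gamma 0 x1 (sparse_oracle slope eps Q) t.
have low : (\int[P]_w (eps - eps / N%:R *
    \sum_(1 <= s < T.+1) (xi s w : nat)%:R)%:E <= (2^-1 * eps)%:E)%E.
  apply: le_trans avg; rewrite expectation.unlock; apply: le_integral => //.
  - apply: (integrable_determined P xi T (fun w => eps - eps / N%:R *
      \sum_(1 <= s < T.+1) (xi s w : nat)%:R)) => w w' /historyP ww'.
    congr (_ - _ * _); apply: eq_big_nat => s sT.
    by rewrite ww'.
  - apply: (integrable_determined P xi T) => w w' ww'.
    congr (_ * _); apply: eq_big_nat => -[//|t] /= tT.
    by rewrite (xdet t w w' (history_le P xi t T w w' (ltnW tT) ww')).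
  - move=> w _; rewrite lee_fin.
    exact: (adagrad_sparse_slope gamma x1 eps Q slope N eps0 Q0 slope_knot
      (fun s => xi s w)).
move: low; rewrite (expected_sample_sum P _ xi q01 xi_iid) lee_fin => low.
have N0' : 0 < N%:R :> R by rewrite ltr0n.
have : eps * (N%:R * Q) <= eps * (2 * T%:R).
  have : eps / 2 * (2 * N%:R * Q) <= eps / N%:R * (T%:R / Q) * (2 * N%:R * Q).
    rewrite ler_pM2r; first by lra.
    by rewrite !mulr_gt0.
  have -> : eps / N%:R * (T%:R / Q) * (2 * N%:R * Q) = eps * (2 * T%:R).
    by field; rewrite !gt_eqF.
  lra.
by rewrite ler_pM2l.
Qed.

Definition rate_const {R : realType} (p : R) : R :=
  (512 * (1 + 2 `^ (p - 1)^-1))^-1.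

Lemma rate_const_gt0 {R : realType} (p : R) : 0 < rate_const p.
Proof. by rewrite /rate_const invr_gt0 mulr_gt0 ?ltr0n ?addr_gt0 ?powR_gt0. Qed.

(** The condition on ln X makes Delta^2 / gamma^2 the smaller of the two terms of
    K, so that K / eps^2 <= 2 X^2 ln^2 X <= 256 N.  With N Q <= 2 T and
    [noise_ratio_le], this accounts for the factor 512 of [rate_const]. *)
Lemma rate_bound {R : realType} (Delta L p sigma gamma eps : R) (N T : nat) :
  0 < Delta -> 0 < L -> 1 < p -> 0 <= sigma -> 0 < gamma -> 0 < eps ->
  let X := gamma * L / eps in
  64 + Delta / (gamma ^+ 2 * L) <= ln X ->
  X ^+ 2 * ln X ^+ 2 / 128 <= N%:R ->
  N%:R * slowdown p sigma eps <= 2 * T%:R ->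
  forall K, K = Delta ^+ 2 / gamma ^+ 2 + gamma ^+ 2 * L ^+ 2 * ln X ^+ 2 ->
  rate_const p * (K / eps ^+ 2 +
     K * sigma `^ (p / (p - 1)) / eps `^ ((3 * p - 2) / (p - 1))) <= T%:R.
Proof.
move=> D0 L0 p1 sigma0 gamma0 eps0 X lX XN NT K KD; rewrite noisy_rateE//.
set D := Delta / (gamma ^+ 2 * L) in lX.
have D0' : 0 <= D by rewrite divr_ge0 ?mulr_ge0 ?sqr_ge0// ltW.
have KE : K / eps ^+ 2 = X ^+ 2 * (D ^+ 2 + ln X ^+ 2).
  by rewrite KD /D /X; set l := ln _; field; rewrite !gt_eqF.
have KN : K / eps ^+ 2 <= 256 * N%:R.
  rewrite KE; have : D ^+ 2 <= ln X ^+ 2 by rewrite ler_sqr ?nnegrE; lra.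
  have := sqr_ge0 X; set x2 := X ^+ 2 in XN *.
  set l2 := ln X ^+ 2 in XN *; set d2 := D ^+ 2; nra.
have b0 : 0 < 1 + 2 `^ (p - 1)^-1 :> R by rewrite addr_gt0// powR_gt0.
rewrite /rate_const ler_pdivrMl; last by rewrite mulr_gt0 ?ltr0n ?b0.
have K0 : 0 <= K / eps ^+ 2 by rewrite KE mulr_ge0 ?addr_ge0 ?sqr_ge0.
have n0 : 0 <= 1 + noise_ratio p sigma eps by rewrite addr_ge0// powR_ge0.
have := noise_ratio_le p sigma eps; set r := noise_ratio p sigma eps in n0 *.
move=> rQ; apply: (le_trans (ler_pM K0 n0 KN rQ)).
rewrite mulrCA; set B := 1 + _ in b0 *.
have := ler_wpM2l (ltW b0) NT; lra.
Qed.

Theorem theorem3p3 (R : realType) :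
  exists a : R, 0 < a /\
  exists c : R -> R, (forall p : R, 1 < p <= 2 -> 0 < c p) /\
  forall Delta L p sigma x1 gamma : R,
  0 < Delta -> 0 < L -> 1 < p <= 2 -> 0 <= sigma -> 0 < gamma ->
  exists2 eps0 : R, 0 < eps0 &
  forall eps : R, 0 < eps -> eps <= Num.sqrt (2 * Delta * L) -> eps <= eps0 ->
  exists f : R -> R,
    (forall x : R, derivable f x 1) /\
    (has_lbound (range f) /\ f x1 - inf (range f) <= Delta) /\
    (forall x y : R, `|derive1 f x - derive1 f y| <= L * `|x - y|) /\
    (* the oracle: queried at x it returns G x s for a fresh sample s of mu *)
    exists (dXi : measure_display) (Xi : measurableType dXi)
           (mu : probability Xi R) (G : R -> Xi -> R),
      measurable_fun [set: R * Xi] (fun z : R * Xi => G z.1 z.2) /\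
      forall (d : measure_display) (Omega : measurableType d)
             (P : probability Omega R) (xi : nat -> {RV P >-> Xi}),
      iid_samples mu xi ->
      let x (t : nat) (w : Omega) : R :=
        adagrad_x gamma 0 x1 (fun s y => G y (xi s w)) t in
      let g (t : nat) (w : Omega) : R :=
        adagrad_g gamma 0 x1 (fun s y => G y (xi s w)) t in
      let F (t : nat) : set_system Omega := natural_filtration g t in
      (forall t : nat, (1 <= t)%N ->
         is_cond_expectation P (F t.-1) (g t) (fun w => derive1 f (x t w)) /\
         cond_expectation_le P (F t.-1)
           (fun w => `|g t w - derive1 f (x t w)| `^ p) (sigma `^ p)) /\
      (forall T : nat, (1 <= T)%N ->
         ('E_P[(fun w => T%:R^-1 * \sum_(1 <= t < T.+1) `|derive1 f (x t w)|)%R]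
            <= (a * eps)%:E)%E ->
         let K := Delta ^+ 2 / gamma ^+ 2 +
                  gamma ^+ 2 * L ^+ 2 * ln (gamma * L / eps) ^+ 2 in
         c p * (K / eps ^+ 2 +
                K * sigma `^ (p / (p - 1)) / eps `^ ((3 * p - 2) / (p - 1)))
           <= T%:R).
Proof.
exists 2^-1; split; first by rewrite invr_gt0.
exists rate_const; split; first by move=> *; exact: rate_const_gt0.
move=> Delta L p sigma x1 gamma Delta0 L0 /andP[p1 _] sigma0 gamma0.
(* eps <= Delta / gamma bounds the loss inside a gap by Delta; the other bound
   on eps makes ln (gamma L / eps) at least l0 *)
set l0 := 64 + Delta / (gamma ^+ 2 * L).
exists (Num.min (Delta / gamma) (gamma * L / expR l0)).
  by rewrite lt_min !divr_gt0 ?mulr_gt0// expR_gt0.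
move=> eps eps0 epsD; rewrite le_min => /andP[eps_gamma eps_l0].
set X := gamma * L / eps.
have X0 : 0 < X by rewrite divr_gt0// mulr_gt0.
have lX : l0 <= ln X.
  rewrite -(expRK l0) ler_ln ?posrE ?expR_gt0// /X ler_pdivlMr// mulrC.
  by rewrite -ler_pdivlMr// expR_gt0.
have [|N [XN NX]] := horizon_exists X X0.
  apply: le_trans lX; rewrite lerDl divr_ge0 ?mulr_ge0 ?sqr_ge0 ?ltW//.
have N0 : (0 < N)%N.
  rewrite -(ltr0n R); apply: lt_le_trans XN.
  have lX0 : 0 < ln X.
    by apply: lt_le_trans lX; rewrite ltr_wpDr// divr_ge0 ?mulr_ge0 ?sqr_ge0 ?ltW.
  by rewrite divr_gt0// mulr_gt0// exprn_gt0.
pose h (j : nat) : R := gamma / Num.sqrt j.+1%:R.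
have h0 j : 0 <= h j by rewrite divr_ge0 ?sqrtr_ge0// ltW.
pose f := landscape x1 eps L h N.
have fD (x : R) : is_derive x 1 f (landscape' x1 eps L h N x).
  exact: is_derive_landscape.
have fE : derive1 f = landscape' x1 eps L h N.
  by apply/funext => x; rewrite derive1E derive_val.
have f_lip := landscape'_lipschitz x1 eps L h (ltW eps0) L0 h0 N.
have f_ge x : - Delta <= f x.
  apply: landscape_ge => //; first exact: ltW.
  - move=> n _; rewrite -[leRHS](divfK (lt0r_neq0 gamma0)).
    apply: ler_pM => //; first exact: ltW.
    rewrite /h ler_pdivrMr ?sqrtr_gt0// ler_peMr ?(ltW gamma0)//.
    by rewrite -[leLHS]sqrtr1 ler_wsqrtr// ler1n.
  - have : eps ^+ 2 <= 2 * Delta * L.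
      rewrite -[leRHS]sqr_sqrtr; last by rewrite !mulr_ge0// ltW.
      by rewrite ler_sqr ?nnegrE ?sqrtr_ge0// ltW.
    rewrite ler_pdivrMr ?mulr_gt0//; lra.
  - apply: adagrad_climb => //.
    move: NX; rewrite /X -(ler_pM2r eps0).
    have -> : gamma * L / eps * ln N.+1%:R * eps = gamma * L * ln N.+1%:R.
      by field; rewrite gt_eqF.
    lra.
exists f; split; first by move=> x; exact: ex_derive.
split.
  split; first by exists (- Delta) => _ [x _ <-].
  rewrite /f landscape_start//; [|exact: ltW].
  rewrite sub0r lerNl; apply: lb_le_inf; first by exists (f x1); exists x1.
  by move=> _ [x _ <-].
split; first by rewrite fE.
pose Q := slowdown p sigma eps.
have Q1 : 1 <= Q by exact: slowdown_ge1.
have Q0 : 0 < Q by exact: lt_le_trans Q1.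
have q01 : 0 <= Q^-1 <= 1 by rewrite invr_ge0 (ltW Q0) invf_le1.
pose G := sparse_oracle (derive1 f) eps Q.
have mf : measurable_fun [set: R] (derive1 f).
  by rewrite fE; exact: measurable_lipschitz f_lip.
have mG := measurable_sparse_oracle _ eps Q mf.
exists _, bool, (bernoulli_prob Q^-1), G; split => //.
move=> d Omega P xi xi_iid x g F; split; last first.
  move=> T T1 avg.
  apply: (rate_bound Delta L p sigma gamma eps N T) => //.
  apply: large_average_slope xi_iid avg => //.
  by move=> k kN; rewrite fE landscape'_knot//; exact: ltW.
have mGb b : measurable_fun [set: R] (G^~ b).
  exact: (measurableT_comp mG (pair2_measurable b)).
have cond := adagrad_cond_expectation P Q^-1 xi q01 xi_iid gamma 0 x1 G (lexx 0).
move=> [//|n] _ /=; split.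
  have := cond n G mGb; congr is_cond_expectation.
  by apply/funext => w; exact: sparse_oracle_mean.
pose u y b := `|G y b - derive1 f y| `^ p.
exists (fun w => Q^-1 * u (x n.+1 w) true + (1 - Q^-1) * u (x n.+1 w) false).
  apply: (cond n u) => b.
  apply: (measurableT_comp (measurable_powR p)).
  apply: measurableT_comp => //.
  exact: measurable_funB.
apply: aeW => w; apply: sparse_oracle_moment => //.
exact: slowdown_budget.
Qed.
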